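(* For all integers $d,k\ge 1$ and every real $\delta>0$ there exists a constant $\tilde c=\tilde c(d,\delta,k)>0$ such that the following holds. Let $n\ge k$, and let $P$ and $\rho$ be sets of $n$ and $k$ points, respectively, each in general position in $\mathbb{R}^d$. Suppose that there exist at least $\delta\binom{n}{k}$ subsets of $k$ elements of $P$ with the same order type as $\rho$. Then there exist pairwise disjoint subsets $X_1,\dots,X_k$ of $P$, each with at least $\tilde c\cdot n$ points, such that for every choice of $x_1\in X_1,\dots,x_k\in X_k$, the point set $\{x_1,\dots,x_k\}$ has the same order type as $\rho$.
   Context: A set of points in $\mathbb{R}^d$ is in general position if no $j\le d+1$ of them lie in a common $(j-2)$-flat (affine subspace of dimension $j-2$). The orientation of a $(d+1)$-tuple of points is $\chi(p_1,\dots,p_{d+1})=\operatorname{sgn}\det M$, where $M$ is the $(d+1)\times(d+1)$ matrix whose $i$-th row is $(1,p_i(1),\dots,p_i(d))$, with $p_i(j)$ the $j$-th coordinate of $p_i$. Two sets $A,B$ of $k$ points in $\mathbb{R}^d$ have the same (unlabelled) order type if there exist bijections $\ell_A:[k]\to A$ and $\ell_B:[k]\to B$, where $[k]=\{1,\dots,k\}$, such that $\chi(\ell_A(i_1),\dots,\ell_A(i_{d+1}))=\chi(\ell_B(i_1),\dots,\ell_B(i_{d+1}))$ for all $1\le i_1<\cdots<i_{d+1}\le k$. *)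

(* Defs.v *)
(* Points of R^d are row vectors over an abstract realType, and finite point sets
   are finmap finite sets of such vectors. *)
From mathcomp Require Import all_boot all_order all_algebra.
From mathcomp Require Import finmap.
From mathcomp Require Import boolp classical_sets reals.

Set Implicit Arguments.
Unset Strict Implicit.
Unset Printing Implicit Defensive.

Import Order.TTheory GRing.Theory Num.Theory.
Local Open Scope ring_scope.
Local Open Scope fset_scope.

Definition flat (R : realType) (d m : nat) (F : set 'rV[R]_d) : Prop :=
  exists (p : 'rV[R]_d) (U : {vspace 'rV[R]_d}),
    \dim U = m /\ F = [set x | x - p \in U]%classic.

(* With j = m + 2: no j <= d + 1 points of P lie in a common (j - 2)-flat.
   The case j = 1 imposes nothing, a (-1)-flat being empty. *)
Definition general_position (R : realType) (d : nat) (P : {fset 'rV[R]_d}) :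
    Prop :=
  forall (m : nat) (S : {fset 'rV[R]_d}) (F : set 'rV[R]_d),
    (m.+2 <= d.+1)%N -> S `<=` P -> #|` S| = m.+2 -> flat m F ->
    ~ (forall x, x \in S -> F x).

Definition orientation_mx (R : realType) (d : nat) (p : 'I_d.+1 -> 'rV[R]_d) :
    'M[R]_d.+1 :=
  \matrix_(i < d.+1) (row_mx (1%:M : 'M[R]_1) (p i) : 'rV[R]_(1 + d)).

Definition chi (R : realType) (d : nat) (p : 'I_d.+1 -> 'rV[R]_d) : R :=
  Num.sg (\det (orientation_mx p)).

(* A and B are coerced to the finite types of their elements, so the
   bijections below force A and B to have exactly k points. *)
Definition same_order_type (R : realType) (d k : nat)
    (A B : {fset 'rV[R]_d}) : Prop :=
  exists (lA : 'I_k -> A) (lB : 'I_k -> B),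
    [/\ bijective lA, bijective lB &
      forall i : 'I_d.+1 -> 'I_k,
        (forall a b : 'I_d.+1, (a < b)%N -> (i a < i b)%N) ->
        chi (fun a => val (lA (i a))) = chi (fun a => val (lB (i a)))].

(* Main.v *)
(* Cutting up space by a bounded random sample of hyperplanes (Clarkson's
   argument) shows that boundedly many sign conditions on a linear functional
   decide its sign on a positive fraction of any finite point set. Applied to one
   variable of a determinant after another, this yields the same-type lemma: k
   nonempty finite sets have subsets of positive proportion all of whose
   transversals have the same orientations. A same-type box either consists of
   copies of rho, or contains none; in the latter case it is removed, and one of
   the other boxes obtained by splitting every factor has a copy density larger by
   a constant factor. As densities are at most 1, this stops after boundedly many
   steps. An average over colourings of P by k colours provides the initial
   disjoint factors. *)
Require Import Defs.
From mathcomp Require Import all_boot all_order all_algebra.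
From mathcomp Require Import finmap.
From mathcomp Require Import boolp classical_sets reals.
From mathcomp Require Import finset zify ring lra.

Set Implicit Arguments.
Unset Strict Implicit.
Unset Printing Implicit Defensive.

Import Order.TTheory GRing.Theory Num.Theory.
Local Open Scope ring_scope.

(** * Sign-compatible rays *)

Definition dot (F : realFieldType) (D : nat) (x phi : 'rV[F]_D) : F :=
  (x *m phi^T) 0 0.

Section Dot.
Variables (F : realFieldType) (D : nat).
Implicit Types (x phi psi : 'rV[F]_D) (a : F).

Lemma dotDr x phi psi : dot x (phi + psi) = dot x phi + dot x psi.
Proof. by rewrite /dot linearD mulmxDr mxE. Qed.

Lemma dotZr x a phi : dot x (a *: phi) = a * dot x phi.
Proof. by rewrite /dot linearZ -scalemxAr mxE. Qed.

Lemma dotNr x phi : dot x (- phi) = - dot x phi.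
Proof. by rewrite -scaleN1r dotZr mulN1r. Qed.

Lemma dot0l phi : dot 0 phi = 0.
Proof. by rewrite /dot mul0mx mxE. Qed.

Lemma dot0r x : dot x 0 = 0.
Proof. by rewrite /dot linear0 mulmx0 mxE. Qed.

Lemma dotE x phi : dot x phi = \sum_i x 0 i * phi 0 i.
Proof. by rewrite /dot mxE; apply: eq_bigr => i _; rewrite mxE. Qed.

Lemma dot_delta i phi : dot (delta_mx 0 i) phi = phi 0 i.
Proof. by rewrite /dot -rowE !mxE. Qed.

Lemma dot_mulr q x (a : 'rV[F]_q) (M : 'M[F]_(q, D)) :
  dot x (a *m M) = \sum_i a 0 i * dot x (row i M).
Proof.
rewrite dotE (eq_bigr (fun j => \sum_i a 0 i * (x 0 j * M i j))); last first.
  by move=> j _; rewrite mxE mulr_sumr; apply: eq_bigr => i _; ring.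
rewrite exchange_big /=; apply: eq_bigr => i _.
by rewrite dotE mulr_sumr; apply: eq_bigr => j _; rewrite mxE.
Qed.

Lemma mulmx_tr_row q (phi : 'rV[F]_D) (U : 'M[F]_(q, D)) :
  (phi *m U^T = 0) <-> (forall i, dot (row i U) phi = 0).
Proof.
have E i : (phi *m U^T) 0 i = dot (row i U) phi.
  by rewrite dotE mxE; apply: eq_bigr => j _; rewrite !mxE mulrC.
split=> [H i|H]; first by rewrite -E H mxE.
by apply/rowP => i; rewrite E H mxE.
Qed.

End Dot.

Section Rigid.
Variables (F : realFieldType) (D : nat) (J : finType) (y : J -> 'rV[F]_D).
Implicit Types (phi psi r : 'rV[F]_D).

(** The hyperplanes orthogonal to the [y j] cut space into cones; this says that [r] lies in the
    closure of the cone whose relative interior contains [phi]. *)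
Definition compat phi r :=
  forall j, dot (y j) r != 0 -> Num.sg (dot (y j) r) = Num.sg (dot (y j) phi).

(** For nonzero [r] this means that [r] spans a one-dimensional face of the arrangement. *)
Definition rigid r :=
  forall psi, (forall j, dot (y j) r = 0 -> dot (y j) psi = 0) ->
  exists c, psi = c *: r.

Definition raycode : finType := ({ffun 'I_D -> option J} * bool)%type.

(* A ray is encoded by at most [D] members of the family whose common kernel is
   the line it spans, together with a choice of one of the two halves. *)
Definition ray (c : raycode) : 'rV[F]_D :=
  (-1) ^+ c.2 *: nz_row (kermx (\matrix_(i < D) oapp y 0 (c.1 i))^T).

Lemma compat_trans phi psi r : compat phi psi -> compat psi r -> compat phi r.
Proof.
move=> H1 H2 j Hj; rewrite H2 // H1 // -sgr_eq0 -H2 //.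
by rewrite sgr_eq0.
Qed.

Lemma compat0 phi r j : compat phi r -> dot (y j) phi = 0 -> dot (y j) r = 0.
Proof.
move=> H H0; apply/eqP/negP => /negP Hj.
by move: (H _ Hj); rewrite H0 sgr0 => /eqP; rewrite sgr_eq0 (negPf Hj).
Qed.

Lemma compatZ phi r t : 0 < t -> compat phi r -> compat phi (t *: r).
Proof.
move=> t0 H j; rewrite dotZr mulf_eq0 negb_or => /andP[_ Hj].
by rewrite sgrM gtr0_sg // mul1r H.
Qed.

(** Ratio test: [t] is the smallest ratio [G j] over the indices where both functionals have the
    same strict sign, the first moment at which [phi - t *: psi] meets such a hyperplane. At the
    other indices the subtraction cannot reverse a sign. *)
Lemma pivot phi psi :
  (forall j, dot (y j) phi = 0 -> dot (y j) psi = 0) ->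
  (exists j, 0 < dot (y j) phi * dot (y j) psi) ->
  exists t, [/\ 0 < t, compat phi (phi - t *: psi) &
    exists j, dot (y j) psi != 0 /\ dot (y j) (phi - t *: psi) = 0].
Proof.
move=> Hz [j0 Hj0].
pose P j := 0 < dot (y j) phi * dot (y j) psi.
pose G j := dot (y j) phi / dot (y j) psi.
have [j1 Pj1 Hmin] := @arg_minP _ _ _ j0 P G Hj0.
have n1 : dot (y j1) psi != 0.
  by apply: contraTneq Pj1 => e; rewrite /P e mulr0 ltxx.
have Gpos : 0 < G j1.
  have -> : G j1 = dot (y j1) phi * dot (y j1) psi / (dot (y j1) psi) ^+ 2.
    by rewrite /G; field.
  by rewrite divr_gt0 // exprn_even_gt0.
exists (G j1); split => //; last first.
  exists j1; split=> //; rewrite dotDr dotNr dotZr /G; field; exact: n1.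
move=> j; rewrite dotDr dotNr dotZr => Hj.
have nphi : dot (y j) phi != 0.
  by apply: contraNneq Hj => e; rewrite (Hz _ e) e mulr0 subr0.
(* Equality of signs is read off from the product of the old and the new value, which is nonnegative
   and has nonzero factors. *)
have H : 0 <= dot (y j) phi * (dot (y j) phi - G j1 * dot (y j) psi).
  have [Pj|] := boolP (P j).
    have := Hmin _ Pj.
    have n2 : dot (y j) psi != 0.
      by apply: contraTneq Pj => e; rewrite /P e mulr0 ltxx.
    have -> : dot (y j) phi * (dot (y j) phi - G j1 * dot (y j) psi)
      = (dot (y j) phi * dot (y j) psi) * (G j - G j1).
      by rewrite /G; field; rewrite n1 n2.
    by move=> le; rewrite mulr_ge0 ?subr_ge0 // ltW.
  rewrite /P -leNgt => Pj.
  have -> : dot (y j) phi * (dot (y j) phi - G j1 * dot (y j) psi)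
    = (dot (y j) phi) ^+ 2 + G j1 * - (dot (y j) phi * dot (y j) psi) by ring.
  by rewrite addr_ge0 ?sqr_ge0 // mulr_ge0 ?oppr_ge0 // ltW.
have Hgt : 0 < dot (y j) phi * (dot (y j) phi - G j1 * dot (y j) psi).
  by rewrite lt_neqAle H andbT eq_sym mulf_neq0.
have : Num.sg (dot (y j) phi * (dot (y j) phi - G j1 * dot (y j) psi)) = 1.
  exact: gtr0_sg.
rewrite sgrM; case: (sgrP (dot (y j) phi)) nphi => //; case: sgrP Hj => //; lra.
Qed.

(** By rigidity the members vanishing at [r] have the line of [r] as common kernel, and at most [D]
    independent ones among them already cut it out. The boolean records the sign of the scalar. *)
Lemma rigid_ray r : r != 0 -> rigid r ->
  exists c t, 0 < t /\ ray c = t *: r.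
Proof.
move=> r0 Hr.
pose A : 'M[F]_(#|J|, D) := \matrix_(j < #|J|)
  (if dot (y (enum_val j)) r == 0 then y (enum_val j) else 0).
pose f := maxrankfun A.
(* Slots from [\rank A] on are padded with [None], which stands for a zero row and imposes no
   condition. *)
pose s : {ffun 'I_D -> option J} := [ffun i : 'I_D =>
  if (insub (val i) : option 'I_(\rank A)) is Some i' then
  let j := enum_val (f i') in if dot (y j) r == 0 then Some j else None
  else None].
pose U : 'M[F]_D := \matrix_(i < D) oapp y 0 (s i).
have AU : (A <= U)%MS.
  rewrite -(eq_maxrowsub A); apply/row_subP => i.
  have lei : (i < D)%N by apply: leq_trans (rank_leq_col A).
  rewrite (_ : row i _ = row (Ordinal lei) U); first exact: row_sub.
  rewrite /U rowK /s ffunE /= insubT //= => pf.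
  apply/rowP => k; rewrite !mxE.
  have -> : Sub (val i) pf = i by apply: val_inj.
  by case: ifP => _ /=; rewrite ?mxE.
have rU : (r <= kermx U^T)%MS.
  apply/sub_kermxP/mulmx_tr_row => i; rewrite rowK ffunE.
  case: insubP => [i' _ _|_] /=; last exact: dot0l.
  by case: ifP => [/eqP //|_] /=; exact: dot0l.
pose z := nz_row (kermx U^T).
have z0 : z != 0.
  rewrite nz_row_eq0; apply: contraNneq r0 => e.
  by move: rU; rewrite e submx0.
have zU : z *m U^T = 0 by apply/sub_kermxP/nz_row_sub.
have zA : z *m A^T = 0.
  by case/submxP: AU => B ->; rewrite trmx_mul mulmxA zU mul0mx.
have [c zc] : exists c, z = c *: r.
  apply: Hr => j Hj; move/mulmx_tr_row: zA => /(_ (enum_rank j)).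
  by rewrite rowK enum_rankK Hj eqxx.
have c0 : c != 0 by apply: contraNneq z0 => e; rewrite zc e scale0r.
exists (s, c < 0), `|c|; split; first by rewrite normr_gt0.
by rewrite /ray /= -/U -/z zc scalerA -normrEsign.
Qed.

(** Makes all the cones pointed: none contains a line, so nonzero ones have extreme rays. *)
Hypothesis ysep : forall phi, (forall j, dot (y j) phi = 0) -> phi = 0.

Lemma sep_neq0 phi : phi != 0 -> exists j, dot (y j) phi != 0.
Proof.
move=> H; apply/existsP; apply: contraNT H; rewrite negb_exists => /forallP H.
by apply/eqP/ysep => j; apply/eqP; move: (H j); rewrite negbK.
Qed.

Lemma compat_card phi psi :
  compat phi psi -> (exists j, dot (y j) phi != 0 /\ dot (y j) psi = 0) ->
  (#|[pred j | dot (y j) psi != 0%R]| < #|[pred j | dot (y j) phi != 0%R]|)%N.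
Proof.
move=> H [j [Hj Hj']]; apply: proper_card; apply/properP; split.
  apply/fintype.subsetP => i; rewrite !inE; apply: contraNneq => e.
  by rewrite (compat0 H e).
by exists j; rewrite !inE ?Hj // Hj' eqxx.
Qed.

(** If [phi] is not rigid, some [psi] vanishes wherever [phi] does without being a multiple of it.
    Moving along [psi] or [- psi] up to the next hyperplane stays in the closed cone and lowers the
    number of nonzero values. *)
Lemma compat_ray phi : phi != 0 ->
  exists c, ray c != 0 /\ compat phi (ray c).
Proof.
move: {2}#|_| (leqnn #|[pred j | dot (y j) phi != 0%R]|) => n.
elim: n phi => [|n IH] phi.
  by move=> + /sep_neq0[j Hj]; rewrite leqn0 => /eqP/card0_eq/(_ j); rewrite inE Hj.
move=> Hn phi0.
have [rig|/existsNP[psi /not_implyP[Hz Hpsi]]] := pselect (rigid phi).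
  have [c [t [t0 E]]] := rigid_ray phi0 rig.
  exists c; rewrite E scaler_eq0 negb_or (gt_eqF t0) phi0; split=> //.
  by apply: compatZ.
have psi0 : psi != 0.
  by apply: contra_notN Hpsi => /eqP ->; exists 0; rewrite scale0r.
have [j Hj] := sep_neq0 psi0.
have Hj' : dot (y j) phi != 0 by apply: contraNneq Hj => e; rewrite Hz.
wlog Hpos : psi Hz Hpsi psi0 Hj / 0 < dot (y j) phi * dot (y j) psi.
  move=> W; have [|h|/eqP] := ltgtP 0 (dot (y j) phi * dot (y j) psi).
  - exact: W.
  - apply: (W (- psi)).
    + by move=> i /Hz e; rewrite dotNr e oppr0.
    + by case=> c e; apply: Hpsi; exists (- c); rewrite scaleNr -e opprK.
    + by rewrite oppr_eq0.
    + by rewrite dotNr oppr_eq0.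
    + by rewrite dotNr mulrN oppr_gt0.
  - by rewrite eq_sym mulf_eq0 (negPf Hj) (negPf Hj').
have [|t [t0 Hc [i [Hi Hi']]]] := pivot Hz; first by exists j.
have [||c [Hc0 Hc1]] := IH (phi - t *: psi).
- rewrite -ltnS; apply: leq_trans Hn; apply: compat_card => //.
  by exists i; split=> //; apply: contraNneq Hi => e; rewrite Hz.
- apply: contra_notN Hpsi; rewrite subr_eq0 => /eqP ->; exists t^-1.
  by rewrite scalerA mulVf ?scale1r // gt_eqF.
by exists c; split=> //; apply: compat_trans Hc1.
Qed.

Definition raymx (cs : seq raycode) : 'M[F]_(size cs, D) :=
  \matrix_(i < size cs) ray (tnth (in_tuple cs) i).

(* Simplicial decomposition: repeatedly subtracting the largest multiple of an
   extreme ray that keeps all signs lands on a proper face. *)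
Lemma ray_decomposition phi :
  exists (cs : seq raycode) (a : 'rV[F]_(size cs)),
    [/\ row_free (raymx cs), phi = a *m raymx cs, forall i, 0 < a 0 i &
        forall i, compat phi (row i (raymx cs))].
Proof.
move: {2}#|_| (leqnn #|[pred j | dot (y j) phi != 0%R]|) => n.
elim: n phi => [|n IH] phi Hn.
all: have [->|phi0] := eqVneq phi 0; first (exists [::], 0; split;
   [by apply: inj_row_free => v _; apply: thinmx0|by rewrite mul0mx|by case|by case]).
  have [j Hj] := sep_neq0 phi0.
  by move: Hn; rewrite leqn0 => /eqP/card0_eq/(_ j); rewrite inE Hj.
have [c [c0 Hc]] := compat_ray phi0.
have [j Hj] := sep_neq0 c0.
have Hz i : dot (y i) phi = 0 -> dot (y i) (ray c) = 0 by apply: compat0.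
have Hj' : dot (y j) phi != 0 by apply: contraNneq Hj => e; rewrite Hz.
have [|t [t0 Ht [i [Hi Hi']]]] := pivot Hz.
  by exists j; rewrite -sgr_gt0 sgrM (Hc _ Hj) -expr2 exprn_even_gt0 // sgr_eq0.
have [|cs [a [Hfree Hphi Ha Hcs]]] := IH (phi - t *: ray c).
  rewrite -ltnS; apply: leq_trans Hn; apply: compat_card => //.
  by exists i; split=> //; apply: contraNneq Hi => e; rewrite Hz.
have E : raymx (c :: cs) = col_mx (ray c) (raymx cs) :> 'M_(1 + size cs, D).
  apply/row_matrixP => k; rewrite rowK.
  case: (@split_ordP 1 (size cs) k) => k' ->.
    by rewrite [RHS]rowKu row_id ord1 (tnth_nth c).
  by rewrite [RHS]rowKd rowK !(tnth_nth c) /=.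
exists (c :: cs), (row_mx (const_mx t) a : 'rV_(1 + size cs)); split.
(* The index [i] given by [pivot] proves freeness: [y i] vanishes on all rays of the shorter list,
   by compatibility, but not on [ray c], so [ray c] has coefficient 0 in any relation. *)
- have H : forall v : 'rV_(1 + size cs), v *m col_mx (ray c) (raymx cs) = 0 -> v = 0.
    move=> v; rewrite -[v]hsubmxK mul_row_col => e.
    have e' : lsubmx v 0 0 *: ray c + rsubmx v *m raymx cs = 0.
      rewrite -e; congr (_ + _); rewrite {2}[lsubmx v]mx11_scalar.
      by rewrite mul_scalar_mx.
    have v0 : lsubmx v 0 0 = 0.
      have := congr1 (dot (y i)) e'; rewrite dotDr dotZr dot0r dot_mulr big1.
        by rewrite addr0 => /eqP; rewrite mulf_eq0 (negPf Hi) orbF => /eqP.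
      by move=> k _; rewrite (compat0 (Hcs k)) // mulr0.
    have l0 : lsubmx v = 0 by rewrite [lsubmx v]mx11_scalar v0 raddf0.
    move: e; rewrite l0 mul0mx add0r => e.
    have : rsubmx v *m raymx cs = 0 *m raymx cs by rewrite e mul0mx.
    by move/(row_free_inj Hfree) ->; rewrite row_mx0.
  rewrite E; exact: inj_row_free H.
- have E2 : row_mx (const_mx t) a *m col_mx (ray c) (raymx cs) = phi.
    rewrite mul_row_col -Hphi (_ : const_mx t = t%:M); last first.
      by apply/matrixP => ? ?; rewrite !ord1 !mxE eqxx mulr1n.
    by rewrite mul_scalar_mx addrC subrK.
  rewrite E; exact: esym E2.
- have E3 (k : 'I_(1 + size cs)) : 0 < row_mx (const_mx t) a 0 k.
    by case: (split_ordP k) => k' ->; rewrite ?row_mxEl ?row_mxEr ?mxE.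
  exact: E3.
- have E4 (k : 'I_(1 + size cs)) : compat phi (row k (col_mx (ray c) (raymx cs))).
    case: (split_ordP k) => k' ->; first by rewrite rowKu row_id.
    by rewrite rowKd; apply: compat_trans (Hcs k').
  by move=> k; rewrite E; exact: E4.
Qed.

End Rigid.

(** * Sampling *)

(** Serves to pick a sample size for which the union bound succeeds. With [m] itself a power of 2,
    the claim reduces to comparing exponents, and there a cube bounds the left side. *)
Lemma poly_lt_expn (a b c e : nat) :
  exists m, (a * (m + b) ^ c * 2 ^ e < 2 ^ m)%N.
Proof.
pose n := (a + b + c + e + 4)%N; exists (2 ^ (3 * n))%N.
have lt2 x : (x < 2 ^ x)%N by apply: ltn_expl.
have H1 : (2 ^ (3 * n) + b <= 2 ^ (3 * n).+1)%N.
  rewrite expnS mul2n -addnn leq_add2l (leq_trans (ltnW (lt2 b))) //.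
  by rewrite leq_exp2l // /n; lia.
have H2 : (a + (3 * n).+1 * c + e <= 2 ^ (3 * n))%N.
  apply: leq_trans (_ : n.+1 ^ 3 <= _)%N; first by rewrite /n !expnS expn0; nia.
  by rewrite mulnC expnM leq_exp2r.
apply: leq_trans (_ : 2 ^ (a + (3 * n).+1 * c + e) <= _)%N; last first.
  by rewrite leq_exp2l.
rewrite (expnD _ (a + _) e) (expnD _ a) (expnM 2 (3 * n).+1 c) ltn_mul2r expn_gt0 /=.
have [e0|Hp] := posnP ((2 ^ (3 * n) + b) ^ c).
  by rewrite e0 muln0 muln_gt0 !expn_gt0.
apply: leq_trans (_ : 2 ^ a * (2 ^ (3 * n) + b) ^ c <= _)%N.
  by rewrite ltn_mul2r Hp lt2.
apply: leq_mul => //; case: (posnP c) => [->|c0]; by rewrite ?expn0 ?leq_exp2r.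
Qed.

Section Sampling.
Variables (T Theta : finType) (X : {set T}) (m t : nat).
Variables (A : Theta -> {set 'I_m}) (K : Theta -> {ffun 'I_m -> T} -> pred T).
Hypothesis cardA : forall th, (#|A th| <= t)%N.
Hypothesis K_local : forall th (S S' : {ffun 'I_m -> T}),
  {in A th, S =1 S'} -> K th S =1 K th S'.

(** In Clarkson's terms, [th] is a configuration determined by the sample points indexed by [A th],
    and [K th S] is its conflict set. A sample is bad if it misses a conflict set covering more than
    half of [X]. *)
Definition bad_samples th : {set {ffun 'I_m -> T}} :=
  [set S in ffun_on (mem X) | [forall j, ~~ K th S (S j)]
     & (#|X| < 2 * #|[set x in X | K th S x]|)%N].

(* Once the coordinates in [A th] are fixed, every other coordinate of a bad
   sample avoids more than half of [X]. *)
Lemma card_bad_samples th :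
  (2 ^ m * #|bad_samples th| <= 2 ^ t * #|X| ^ m)%N.
Proof.
have [->|/set0Pn[S1 HS1]] := eqVneq (bad_samples th) set0.
  by rewrite cards0 muln0.
have [m0|m_gt0] := posnP m.
  apply: leq_trans (_ : 2 ^ m * 1 <= _)%N; last first.
    by rewrite m0 !expn0 !muln1 expn_gt0.
  rewrite leq_mul2l; apply/orP; right; apply: leq_trans (max_card _) _.
  by rewrite card_ffun card_ord m0 expn0.
have [x0 Hx0] : exists x0, x0 \in X.
  move: HS1; rewrite inE => /andP[/ffun_onP H _].
  by exists (S1 (Ordinal m_gt0)); exact: H.
(* Resetting the coordinates outside [A th] to [x0] groups the bad samples by the coordinates that
   determine the conflict set. *)
pose restr (S : {ffun 'I_m -> T}) :=
  [ffun j => if j \in A th then S j else x0].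
have leAm : (#|A th| <= m)%N by rewrite -[X in (_ <= X)%N]card_ord max_card.
have Hfib u : (2 ^ (m - #|A th|) *
    #|[set S in bad_samples th | restr S == u]| <= #|X| ^ (m - #|A th|))%N.
  have [->|/set0Pn[S0 HS0]] := eqVneq [set S in bad_samples th | restr S == u] set0.
    by rewrite cards0 muln0.
  move: (HS0); rewrite !inE => /andP[/and3P[_ _ Hbig] /eqP HS0u].
  pose Q j := if j \in A th then pred1 (S0 j) else
    [pred x | (x \in X) && ~~ K th S0 x].
  have sub : [set S in bad_samples th | restr S == u] \subset family Q.
    apply/fintype.subsetP => S; rewrite !inE -HS0u.
    move=> /andP[/and3P[/ffun_onP HX /forallP HK _] /eqP Hr].
    have eqA : {in A th, S =1 S0}.
      by move=> j Hj; move/ffunP/(_ j): Hr; rewrite !ffunE Hj.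
    apply/familyP => j; rewrite /Q; case: ifP => Hj; first by rewrite inE eqA.
    rewrite inE; move: (HX j) => /= ->.
    by rewrite -(K_local eqA) HK.
  have cQ : #|family Q| = (#|[set x in X | ~~ K th S0 x]| ^ (m - #|A th|))%N.
    rewrite card_family foldrE big_map big_enum /=.
    rewrite (bigID (fun j => j \in A th)) /= big1 ?mul1n; last first.
      by move=> j Hj; rewrite /Q Hj card1.
    rewrite (eq_bigr (fun=> #|[set x in X | ~~ K th S0 x]|)); last first.
      by move=> j /negPf Hj; rewrite /Q Hj; apply: eq_card => x; rewrite !inE.
    rewrite prod_nat_const; congr (_ ^ _)%N.
    have := cardC (mem (A th)); rewrite card_ord => cA.
    apply: (@addnI #|A th|); rewrite subnKC // -[RHS]cA; congr (_ + _)%N.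
  apply: leq_trans (_ : 2 ^ (m - #|A th|) * #|family Q| <= _)%N.
    by rewrite leq_mul2l subset_leq_card ?orbT.
  rewrite cQ -expnMn; case: (posnP (m - #|A th|)) => [->|H0]; first by rewrite !expn0.
  rewrite leq_exp2r //.
  have <- : (#|[set x in X | K th S0 x]| + #|[set x in X | ~~ K th S0 x]| = #|X|)%N.
    by rewrite -(cardsID [set x | K th S0 x] X); congr (_ + _)%N;
      apply: eq_card => x; rewrite !inE // andbC.
  move: Hbig; rewrite -(cardsID [set x | K th S0 x] X).
  have -> : X :&: [set x | K th S0 x] = [set x in X | K th S0 x].
    by apply/setP => x; rewrite !inE.
  have -> : X :\: [set x | K th S0 x] = [set x in X | ~~ K th S0 x].
    by apply/setP => x; rewrite !inE andbC.
  by lia.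
have Hsum : (2 ^ (m - #|A th|) * #|bad_samples th| <= #|X| ^ m)%N.
  have -> : #|bad_samples th| = (\sum_(u in pffun_on x0 (mem (A th)) (mem X))
      #|[set S in bad_samples th | restr S == u]|)%N.
    rewrite -sum1_card (partition_big restr (mem (pffun_on x0 (mem (A th)) (mem X)))) /=.
      apply: eq_bigr => u _; rewrite -sum1_card; apply: eq_bigl => S.
      by rewrite [in RHS]inE.
    move=> S; rewrite inE => /andP[/ffun_onP HX _].
    apply/pfamilyP; split.
      by apply/fintype.subsetP => j; rewrite !inE ffunE; case: ifP => //; rewrite eqxx.
    by move=> j Hj; rewrite ffunE; move: Hj; rewrite /in_mem /= => ->; exact: HX.
  rewrite big_distrr /=.
  apply: leq_trans (_ : \sum_(u in pffun_on x0 (mem (A th)) (mem X))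
     #|X| ^ (m - #|A th|) <= _)%N; first by apply: leq_sum => u _; exact: Hfib.
  by rewrite sum_nat_const card_pffun_on -expnD subnKC.
have -> : (2 ^ m = 2 ^ #|A th| * 2 ^ (m - #|A th|))%N by rewrite -expnD subnKC.
rewrite -mulnA.
by apply: leq_mul => //; rewrite leq_exp2l.
Qed.

(** Union bound: each configuration spoils at most a fraction [2 ^ t / 2 ^ m] of all samples. *)
Lemma exists_good_sample : X != set0 -> (#|Theta| * 2 ^ t < 2 ^ m)%N ->
  exists2 S : {ffun 'I_m -> T}, (forall j, S j \in X) &
    forall th, (forall j, ~~ K th S (S j)) ->
      (2 * #|[set x in X | K th S x]| <= #|X|)%N.
Proof.
move=> X0 Hlt.
have [/exists_inP[S HS /forallP H]|] := boolP [exists S in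
    ffun_on (mem X), forall th, S \notin bad_samples th].
  exists S => [j|th HK]; first by move/ffun_onP: HS; apply.
  rewrite leqNgt; move: (H th); apply: contra => Hb; rewrite inE HS Hb !andbT.
  by apply/forallP.
rewrite negb_exists_in => /forall_inP Hall.
have sub : (ffun_on (mem X) : pred {ffun 'I_m -> T}) \subset
    \bigcup_th bad_samples th.
  apply/fintype.subsetP => S /Hall; rewrite negb_forall => /existsP[th].
  by rewrite negbK => Hth; apply/bigcupP; exists th.
have : (2 ^ m * #|X| ^ m <= #|Theta| * 2 ^ t * #|X| ^ m)%N.
  have -> : (#|X| ^ m = #|(ffun_on (mem X) : pred {ffun 'I_m -> T})|)%N.
    by rewrite card_ffun_on card_ord.
  apply: leq_trans (_ : 2 ^ m * \sum_th #|bad_samples th| <= _)%N.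
    rewrite leq_mul2l; apply/orP; right.
    apply: leq_trans (subset_leq_card sub) _.
    elim/big_rec2: _ => [|th n B _ IH]; first by rewrite cards0.
    by apply: leq_trans (leq_card_setU _ _) _; rewrite leq_add2l.
  rewrite big_distrr /= -mulnA -sum_nat_const; apply: leq_sum => th _.
  by apply: leq_trans (card_bad_samples th) _; rewrite card_ffun_on card_ord.
by rewrite leq_mul2r expn_eq0 cards_eq0 (negPf X0) /= leqNgt Hlt.
Qed.

End Sampling.

(** * Cuttings *)

(** The right-hand side does not mention [a]: all positive combinations of the same nonnegative
    numbers share one sign. *)
Lemma sgr_sum_pos (F : realFieldType) q (a z : 'I_q -> F) :
  (forall i, 0 < a i) -> (forall i, 0 <= z i) ->
  Num.sg (\sum_i a i * z i) = ([exists i, 0 < z i])%:R.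
Proof.
move=> a0 z0; have [/existsP[i Hi]|] := boolP [exists i, 0 < z i].
  apply: gtr0_sg; rewrite (bigD1 i) //= ltr_wpDr ?mulr_gt0 //.
  by apply: sumr_ge0 => j _; rewrite mulr_ge0 // ltW.
rewrite negb_exists => /forallP H; rewrite big1 ?sgr0 // => i _.
have := H i; rewrite -leNgt => le.
by rewrite (le_anti (_ : z i <= 0 <= z i)) ?mulr0 // le z0.
Qed.

Section Region.
Variables (F : realFieldType) (D : nat).

(* The signs of a functional [phi] on this list decide whether [phi] is a positive
   combination of the rows of [M], when these are free. *)
Definition region_tests q (M : 'M[F]_(q, D)) : seq 'rV[F]_D :=
  [seq row k (pinvmx M)^T | k <- enum 'I_q] ++
  [seq row k (cokermx M)^T | k <- enum 'I_D].

(** Passing the tests forces [psi] to be a positive combination of the rows of [M] as well. If [x]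
    does not take both strict signs on these rows, its sign on such a combination is independent of
    the weights. *)
Lemma region_sgr q (M : 'M[F]_(q, D)) (a : 'rV[F]_q) (x phi psi : 'rV[F]_D) :
  row_free M -> phi = a *m M -> (forall i, 0 < a 0 i) ->
  {in region_tests M, forall w, Num.sg (dot w psi) = Num.sg (dot w phi)} ->
  (forall i, 0 <= dot x (row i M)) \/ (forall i, dot x (row i M) <= 0) ->
  Num.sg (dot x psi) = Num.sg (dot x phi).
Proof.
move=> Hf Hphi a0 Htest.
(* The cokernel tests put [psi] in the row space; the pseudoinverse tests then give its coordinates
   the signs of those of [phi]. *)
have Hcok : psi *m cokermx M = 0.
  rewrite -[cokermx M]trmxK; apply/mulmx_tr_row => i.
  apply/eqP; rewrite -sgr_eq0 Htest; last first.
    by rewrite mem_cat; apply/orP; right; apply: map_f; rewrite mem_enum.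
  rewrite sgr_eq0; apply/eqP; move: i; apply/mulmx_tr_row.
  by rewrite trmxK Hphi -mulmxA mulmx_coker mulmx0.
pose b := psi *m pinvmx M.
have Hpsi : psi = b *m M by rewrite mulmxKpV // submxE Hcok.
have b0 i : 0 < b 0 i.
  have E (chi : 'rV_D) : (chi *m pinvmx M) 0 i = dot (row i (pinvmx M)^T) chi.
    by rewrite dotE !mxE; apply: eq_bigr => k _; rewrite !mxE mulrC.
  rewrite -sgr_gt0 E Htest; last first.
    by rewrite mem_cat; apply/orP; left; apply: map_f; rewrite mem_enum.
  by rewrite -E Hphi -mulmxA mulmxVp // mulmx1 sgr_gt0.
rewrite Hpsi Hphi !dot_mulr => -[Hx|Hx]; first by rewrite !sgr_sum_pos.
have Hx' i : 0 <= - dot x (row i M) by rewrite oppr_ge0.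
apply: oppr_inj; rewrite -!sgrN -!sumrN.
under eq_bigr do rewrite -mulrN; under [in RHS]eq_bigr do rewrite -mulrN.
by rewrite !sgr_sum_pos.
Qed.

End Region.

Lemma sgr_pigeonhole (F : realFieldType) (T : finType) (X : {set T}) (f : T -> F) :
  exists s, (#|X| <= 3 * #|[set x in X | Num.sg (f x) == s]|)%N.
Proof.
pose Y s := [set x in X | Num.sg (f x) == s].
have E : (#|X| <= #|Y 1%R| + (#|Y (- 1)%R| + #|Y 0%R|))%N.
  apply: leq_trans (leq_add (leqnn _) (leq_card_setU _ _)).
  apply: leq_trans (leq_card_setU _ _).
  apply/subset_leq_card/fintype.subsetP => x Hx; rewrite !inE Hx /=.
  by case: sgrP => _; rewrite eqxx ?orbT.
have [H1|H1] := leqP #|X| (3 * #|Y 1%R|); first by exists 1.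
have [H2|H2] := leqP #|X| (3 * #|Y (- 1)%R|); first by exists (-1).
by exists 0; move: E H1 H2; rewrite /Y; lia.
Qed.

Section Cutting.
Variables (F : realFieldType) (D : nat).

(** The standard basis is added so that the family separates functionals even when the sampled
    vectors do not span. *)
Definition sample_family (T : Type) (v : T -> 'rV[F]_D) m
    (S : {ffun 'I_m -> T}) (j : 'I_m + 'I_D) : 'rV[F]_D :=
  match j with inl i => v (S i) | inr b => delta_mx 0 b end.

Lemma sample_family_sep (T : Type) (v : T -> 'rV[F]_D) m S phi :
  (forall j, dot (sample_family v (m := m) S j) phi = 0) -> phi = 0.
Proof.
by move=> H; apply/rowP => i; rewrite mxE -(dot_delta i phi); exact: (H (inr i)).
Qed.

(** A list of at most [D] ray codes, stored as a length and a padded tuple. The number of codes is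
    polynomial in [m]. *)
Definition regioncode m : finType :=
  ('I_D.+1 * D.-tuple (raycode D ('I_m + 'I_D)%type))%type.

Definition region_rays m (th : regioncode m) : seq (raycode D ('I_m + 'I_D)%type) :=
  take th.1 th.2.

Lemma region_raysP m (cs : seq (raycode D ('I_m + 'I_D)%type)) :
  (size cs <= D)%N -> exists th, region_rays th = cs.
Proof.
move=> Hs; pose c0 : raycode D ('I_m + 'I_D)%type := ([ffun => None], false).
exists (inord (size cs), [tuple nth c0 cs i | i < D]).
rewrite /region_rays /= inordK // (_ : map _ _ = mkseq (nth c0 cs) D); last first.
  by rewrite /mkseq -val_enum_ord -map_comp.
apply: (@eq_from_nth _ c0); rewrite size_take size_mkseq; first by case: ltngtP Hs.
move=> i; case: (ltnP (size cs) D) => Hs1 Hi; rewrite ?nth_take ?nth_mkseq //;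
  [exact: ltn_trans Hs1|exact: leq_trans Hs1].
Qed.

Definition slot m (th : regioncode m) (p : 'I_D * 'I_D) : option 'I_m :=
  if (tnth th.2 p.1).1 p.2 is Some (inl j) then Some j else None.

Definition used_samples m (th : regioncode m) : {set 'I_m} :=
  [set j | Some j \in codom (slot th)].

Lemma card_used_samples m (th : regioncode m) : (#|used_samples th| <= D * D)%N.
Proof.
rewrite -(card_imset _ (@Some_inj _)).
apply: leq_trans (_ : #|codom (slot th)| <= _)%N.
  apply/subset_leq_card/fintype.subsetP => j /imsetP[i].
  by rewrite inE => Hi ->.
by apply: leq_trans (card_size _) _; rewrite size_map -cardE card_prod !card_ord.
Qed.

Variables (T : finType) (v : T -> 'rV[F]_D).

(** The hyperplane orthogonal to [v x] has generators of the cone strictly on both sides; otherwise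
    [v x] has constant sign on the relatively open cone. *)
Definition crosses m (th : regioncode m) (S : {ffun 'I_m -> T}) (x : T) : bool :=
  ~~ (all (fun c => 0 <= dot (v x) (ray (sample_family v S) c)) (region_rays th) ||
      all (fun c => dot (v x) (ray (sample_family v S) c) <= 0) (region_rays th)).

Lemma crosses_local m (th : regioncode m) (S S' : {ffun 'I_m -> T}) :
  {in used_samples th, S =1 S'} -> crosses th S =1 crosses th S'.
Proof.
move=> H x; rewrite /crosses.
have E : {in region_rays th, ray (sample_family v S) =1 ray (sample_family v S')}.
  move=> c /mem_take /tnthP[k ->]; rewrite /ray.
  congr (_ *: nz_row (kermx _^T)); apply/row_matrixP => i; rewrite !rowK.
  case Ec: ((tnth th.2 k).1 i) => [[j|b]|] //=.
  by rewrite H // inE; apply/codomP; exists (k, i); rewrite /slot /= Ec.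
by congr (~~ (_ || _)); apply: eq_in_all => c Hc; rewrite E.
Qed.

End Cutting.

(** [W] gathers the tests of all cones coded by one good sample, so it is chosen before [phi]. The
    cone of [phi] is crossed by at most half of [X], and the most frequent sign among the other
    points keeps a third of these: hence the factor 6. *)
Lemma cutting (F : realFieldType) (D : nat) :
  exists B, forall (T : finType) (v : T -> 'rV[F]_D) (X : {set T}),
  exists2 W : seq 'rV[F]_D, (size W <= B)%N & forall phi,
  exists (Y : {set T}) s, [/\ Y \subset X, (#|X| <= 6 * #|Y|)%N &
    forall psi, {in W, forall w, Num.sg (dot w psi) = Num.sg (dot w phi)} ->
    {in Y, forall y, Num.sg (dot (v y) psi) = s}].
Proof.
have [m Hm] : exists m, (#|regioncode D m| * 2 ^ (D * D) < 2 ^ m)%N.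
  (* The first three arguments come from the number of codes, [D.+1 * ((m + D.+1) ^ D * 2) ^ D]; the
     last [D * D] bounds the sample points used by one code. *)
  have [m Hm] := poly_lt_expn (D.+1 * 2 ^ D) D.+1 (D * D) (D * D).
  exists m; move: Hm; rewrite card_prod card_ord card_tuple card_prod card_ffun.
  rewrite card_option card_sum card_bool !card_ord addnS expnMn -expnM.
  by rewrite -!mulnA (mulnCA (2 ^ D)%N).
exists (#|regioncode D m| * (D + D))%N => T v X.
have [->|X0] := eqVneq X set0.
  exists [::] => // phi; exists set0, 0; split=> //; first by rewrite cards0.
  by move=> psi _ y; rewrite inE.
have [S HSX HS] := exists_good_sample (@card_used_samples D m)
  (@crosses_local F D T v m) X0 Hm.
pose M th := raymx (sample_family v S) (region_rays th).
exists (flatten [seq region_tests (M th) | th <- enum (regioncode D m)]).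
  rewrite size_flatten /shape -map_comp sumnE big_map big_enum /=.
  rewrite -sum_nat_const; apply: leq_sum => th _.
  rewrite size_cat !size_map -!enumT !size_enum_ord leq_add2r /region_rays size_take.
  by rewrite size_tuple; case: ltnP => // _; rewrite -ltnS.
move=> phi.
have [cs [a [Hf Hphi Ha Hc]]] :=
  ray_decomposition (@sample_family_sep F D T v m S) phi.
have [th Hth] : exists th, region_rays th = cs.
  by apply: region_raysP; move/eqP: (Hf) => {1}<-; exact: rank_leq_col.
have rowE x (P : pred F) : all (fun c => P (dot (v x) (ray (sample_family v S) c))) cs
    <-> forall i, P (dot (v x) (row i (raymx (sample_family v S) cs))).
  split=> [/(all_tnthP (t := in_tuple cs)) H i|H]; first by rewrite rowK; exact: (H i).
  by apply/(all_tnthP (t := in_tuple cs)) => i; move: (H i); rewrite rowK.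
(* Sampled points do not cross the cone, since its rays are compatible with [phi] at every member of
   the sample. *)
have Hnc j : ~~ crosses v th S (S j).
  rewrite negbK Hth.
  have Hi i : dot (v (S j)) (row i (raymx (sample_family v S) cs)) != 0 ->
     Num.sg (dot (v (S j)) (row i (raymx (sample_family v S) cs))) =
     Num.sg (dot (v (S j)) phi) := Hc i (inl j).
  apply/orP; have [Hs|Hs] := leP 0 (dot (v (S j)) phi).
    left; apply/(rowE _ (fun z => 0 <= z)) => i.
    have [->//|/Hi] := eqVneq (dot (v (S j)) (row i (raymx (sample_family v S) cs))) 0.
    by rewrite -[_ <= _]sgr_ge0 => ->; rewrite sgr_ge0.
  right; apply/(rowE _ (fun z => z <= 0)) => i.
  have [->//|/Hi] := eqVneq (dot (v (S j)) (row i (raymx (sample_family v S) cs))) 0.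
  by rewrite -[_ <= _]sgr_le0 => ->; rewrite sgr_le0 ltW.
have Hhalf := HS th Hnc.
pose X' := [set x in X | ~~ crosses v th S x].
have [s Hs] := sgr_pigeonhole X' (fun x => dot (v x) phi).
exists [set x in X' | Num.sg (dot (v x) phi) == s], s; split.
- by apply/fintype.subsetP => x; rewrite !inE => /andP[/andP[]].
- have : (#|X| = #|[set x in X | crosses v th S x]| + #|X'|)%N.
    rewrite -(cardsID [set x | crosses v th S x] X); congr (_ + _)%N;
    by apply: eq_card => x; rewrite !inE // andbC.
  by lia.
move=> psi Hpsi x; rewrite !inE negbK Hth => /andP[/andP[_ Hx] /eqP <-].
apply: (region_sgr Hf Hphi Ha).
  move=> w Hw; apply: Hpsi; apply/flattenP.
  exists (region_tests (M th)); first by apply: map_f; rewrite mem_enum.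
  by rewrite /M Hth.
case/orP: Hx => [/(rowE _ (fun z => 0 <= z)) H|/(rowE _ (fun z => z <= 0)) H];
  by [left|right].
Qed.

(** * The same-type lemma *)

Section Boxes.
Variables (I T : finType).
Implicit Types (X Y Z : I -> {set T}).

Definition subbox N X Y := forall i, Y i \subset X i /\ (#|X i| <= N * #|Y i|)%N.

Lemma subbox_trans M N X Y Z : subbox M X Y -> subbox N Y Z -> subbox (M * N) X Z.
Proof.
move=> H1 H2 i; case: (H1 i) (H2 i) => s1 c1 [s2 c2]; split.
  exact: fintype.subset_trans s2 s1.
by apply: leq_trans c1 _; rewrite -mulnA leq_mul2l c2 orbT.
Qed.

Lemma subbox_le M N X Y : (M <= N)%N -> subbox M X Y -> subbox N X Y.
Proof.
move=> le H i; case: (H i) => s c; split=> //.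
by apply: leq_trans c _; rewrite leq_mul2r le orbT.
Qed.

Lemma subbox_neq0 N X Y :
  subbox N X Y -> (forall i, X i != set0) -> forall i, Y i != set0.
Proof.
move=> H H0 i; case: (H i) => _; have := H0 i.
by rewrite -!card_gt0; case: #|Y i| => //; lia.
Qed.

(** The properties pass to smaller boxes, so they can be imposed one after another, the losses
    multiplying. *)
Lemma subbox_iter (A : eqType) (Q : A -> (I -> {set T}) -> Prop) N (s : seq A) :
  (forall a X Y, (forall i, Y i \subset X i) -> Q a X -> Q a Y) ->
  (forall a X, a \in s -> (forall i, X i != set0) ->
     exists2 Y, subbox N X Y & Q a Y) ->
  forall X, (forall i, X i != set0) ->
  exists2 Y, subbox (N ^ size s) X Y & {in s, forall a, Q a Y}.
Proof.
move=> Qmono; elim: s => [|a s IH] H X X0.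
  by exists X => // i; rewrite mul1n.
have [Y XY QY] := H a X (mem_head _ _) X0.
have [|Z YZ QZ] := IH _ Y (subbox_neq0 XY X0).
  by move=> b X' Hb; apply: H; rewrite inE Hb orbT.
exists Z; first by rewrite /= expnS; exact: subbox_trans XY YZ.
move=> b; rewrite inE => /predU1P[->|]; last exact: QZ.
by apply: (Qmono _ Y) => // i; case: (YZ i).
Qed.

End Boxes.

Section Multilinear.
Variables (F : realFieldType) (D : nat) (I : finType).
Implicit Types (x : I -> 'rV[F]_D) (f : (I -> 'rV[F]_D) -> F).

Definition upd (V : Type) (x : I -> V) j (w : V) : I -> V :=
  fun i => if i == j then w else x i.

Definition linear_at f j :=
  forall x, exists phi, forall w, f (upd x j w) = dot w phi.

(** Coordinates in [J] are active and the others stay frozen at [x], which lets an induction on [J]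
    freeze one coordinate at an arbitrary vector. *)
Definition mixed (T : finType) (J : seq I) (v : T -> 'rV[F]_D) x (t : I -> T) :=
  fun i => if i \in J then v (t i) else x i.

Lemma updC (V : Type) (x : I -> V) i j (a b : V) : i != j ->
  upd (upd x i a) j b = upd (upd x j b) i a.
Proof.
move=> ne; apply/funext => l; rewrite /upd.
by have [->|//] := eqVneq l j; rewrite eq_sym (negPf ne).
Qed.

Lemma linear_at_upd f i j w : i != j -> linear_at f i ->
  linear_at (fun x => f (upd x j w)) i.
Proof.
move=> ne H x; have [phi Hphi] := H (upd x j w).
by exists phi => a; rewrite updC.
Qed.

(* Induction on the active coordinates: the cutting lemma replaces one of them
   by boundedly many fixed vectors. *)
Lemma multilinear_same_sign (J : seq I) : uniq J ->
  exists N, forall (T : finType) (v : T -> 'rV[F]_D) f x (X : I -> {set T}),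
  {in J, forall j, linear_at f j} -> (forall i, X i != set0) ->
  exists2 Y, subbox N X Y &
    exists s, forall t, (forall i, t i \in Y i) -> Num.sg (f (mixed J v x t)) = s.
Proof.
elim: J => [_|j J IH /= /andP[jJ uJ]].
  exists 1%N => T v f x X _ _; exists X => [i|]; first by rewrite mul1n.
  by exists (Num.sg (f x)).
have {IH} [N HN] := IH uJ; have [B HB] := cutting F D.
(* [N.+1 ^ B] pays for one shrinking per test vector, the successor keeping the base positive so
   that the exponent can grow from [size W] to [B]; 6 is the loss of the cutting at coordinate
   [j]. *)
exists (maxn (N.+1 ^ B) 6) => T v f x X Hlin X0.
have [W sW HW] := HB T v (X j).
pose Q w (Y : I -> {set T}) := exists s, forall t, (forall i, t i \in Y i) ->
  Num.sg (f (upd (mixed J v x t) j w)) = s.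
have [|w Z _ Z0|Y XY QY] := @subbox_iter I T _ Q N W _ _ X X0.
- by move=> w Z Y sub [s Hs]; exists s => t Ht; apply: Hs => i;
  apply: (fintype.subsetP (sub i)).
- apply: (HN T v (fun x => f (upd x j w)) x Z) => // i iJ.
  apply: linear_at_upd; first by apply: contraNneq jJ => <-.
  by apply: Hlin; rewrite inE iJ orbT.
have Y0 := subbox_neq0 XY X0.
have [t0 Ht0] : exists t0 : I -> T, forall i, t0 i \in Y i.
  exists (fun i => xchoose (set0Pn _ (Y0 i))) => i; exact: xchooseP.
have Hphi t : exists phi, forall w, f (upd (mixed J v x t) j w) = dot w phi.
  by apply: Hlin; exact: mem_head.
have [phi0 E0] := Hphi t0.
have [Yj [s [sYj cYj HYj]]] := HW phi0.
exists (upd Y j Yj).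
  move=> i; rewrite /upd; have [->|ne] := eqVneq i j.
    by split=> //; apply: leq_trans cYj _; rewrite leq_mul2r leq_maxr orbT.
  move: (i); apply: subbox_le XY.
  apply: leq_trans (leq_maxl _ _); apply: leq_trans (_ : N.+1 ^ size W <= _)%N.
    by case: (size W) => // n; rewrite leq_exp2r.
  exact: leq_pexp2l.
exists s => t Ht.
(* [Yj] is a part of [X j] and may leave [Y j]; resetting coordinate [j] to [t0 j] is harmless
   because [mixed J] ignores it. *)
have Ht' i : upd t j (t0 j) i \in Y i.
  by rewrite /upd; have [->//|ne] := eqVneq i j; have := Ht i; rewrite /upd (negPf ne).
have Emix : mixed J v x (upd t j (t0 j)) = mixed J v x t.
  apply/funext => i; rewrite /mixed /upd; case: ifP => // iJ.
  by have [e|//] := eqVneq i j; rewrite -e iJ in jJ.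
have [phi E] := Hphi t.
have <- : Num.sg (dot (v (t j)) phi) = s.
  apply: HYj; last by have := Ht j; rewrite /upd eqxx.
  by move=> w /QY[sw Hsw]; rewrite -E -E0 -Emix !Hsw.
rewrite -E; congr (Num.sg (f _)); apply/funext => i; rewrite /mixed /upd inE.
by have [->|] := eqVneq i j.
Qed.

End Multilinear.

(** Laplace expansion along row [a]: by injectivity of [e], the coordinate [e a] feeds no other row,
    so the cofactors do not depend on it. *)
Lemma linear_at_det (F : realFieldType) (I : finType) d (e : 'I_d.+1 -> I) a :
  injective e ->
  linear_at (fun x : I -> 'rV[F]_d.+1 => \det (\matrix_(b < d.+1) x (e b))) (e a).
Proof.
move=> inje x; set M := \matrix_b x (e b).
exists (\row_j cofactor M a j) => w.
rewrite (expand_det_row _ a) dotE; apply: eq_bigr => j _.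
rewrite !mxE /upd eqxx; congr (_ * _).
rewrite /cofactor; congr (_ * \det _); apply/matrixP => b c; rewrite !mxE.
by rewrite (inj_eq inje) eq_sym (negPf (neq_lift _ _)).
Qed.

Lemma same_type (F : realFieldType) (I : finType) d : exists N,
  forall (T : finType) (v : T -> 'rV[F]_d.+1) (X : I -> {set T}),
  (forall i, X i != set0) -> exists2 Y, subbox N X Y &
  forall e : 'I_d.+1 -> I, injective e -> exists s, forall t, (forall i, t i \in Y i) ->
    Num.sg (\det (\matrix_(b < d.+1) v (t (e b)))) = s.
Proof.
pose E := [seq e : {ffun 'I_d.+1 -> I} <- enum {ffun 'I_d.+1 -> I} | injectiveb e].
(* For each [e] the active coordinates are those in its range; only these enter the determinant. *)
have [M HM] := boolp.choice (fun e : {ffun 'I_d.+1 -> I} =>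
  multilinear_same_sign F d.+1 (undup_uniq (codom e))).
exists ((\max_e M e) ^ size E)%N => T v X X0.
pose Q (e : {ffun 'I_d.+1 -> I}) (Y : I -> {set T}) :=
  exists s, forall t, (forall i, t i \in Y i) ->
    Num.sg (\det (\matrix_(b < d.+1) v (t (e b)))) = s.
have [|e Z He Z0|Y XY QY] := @subbox_iter I T _ Q (\max_e M e)%N E _ _ X X0.
- by move=> w Z Y sub [s Hs]; exists s => t Ht; apply: Hs => i;
  apply: (fintype.subsetP (sub i)).
- move: He; rewrite mem_filter => /andP[/injectiveP inje _].
  have [|Y ZY [s Hs]] := HM e T v
    (fun x : I -> 'rV[F]_d.+1 => \det (\matrix_(b < d.+1) x (e b))) (fun=> 0) Z _ Z0.
    by move=> j; rewrite mem_undup => /codomP[a ->]; exact: linear_at_det.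
  exists Y; first by apply: subbox_le ZY; exact: leq_bigmax.
  exists s => t Ht; rewrite -(Hs t Ht); congr (Num.sg (\det _)).
  by apply/row_matrixP => b; rewrite !rowK /mixed mem_undup codom_f.
exists Y => // e inje.
have [|s Hs] := QY (finfun e).
  by rewrite mem_filter mem_enum andbT; apply/injectiveP => a b; rewrite !ffunE => /inje.
exists s => t Ht; rewrite -(Hs t Ht); congr (Num.sg (\det _)).
by apply/row_matrixP => b; rewrite !rowK ffunE.
Qed.

(** * Density increment *)

(** Cutting [Y] down to at most half of [X], rounded up, makes the complement a positive proportion
    as well, unless [X] has at most one point; rounding costs the 3. *)
Lemma halving_subset (T : finType) (X Y : {set T}) N :
  Y \subset X -> (#|X| <= N * #|Y|)%N ->
  exists Y' : {set T}, [/\ Y' \subset Y, (#|X| <= maxn N 3 * #|Y'|)%N &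
    X :\: Y' != set0 -> (#|X| <= maxn N 3 * #|X :\: Y'|)%N].
Proof.
move=> sYX cY.
pose s := take (uphalf #|X|) (enum Y).
have us : uniq s by apply/take_uniq/enum_uniq.
have sub : [set x in s] \subset Y.
  by apply/fintype.subsetP => x; rewrite inE => /mem_take; rewrite mem_enum.
have cs : #|[set x in s]| = minn (uphalf #|X|) #|Y|.
  by rewrite cardsE (card_uniqP us) size_take -cardE /minn.
have cD : (#|X :\: [set x in s]| = #|X| - minn (uphalf #|X|) #|Y|)%N.
  by rewrite cardsD (finset.setIidPr _) ?cs //; exact: fintype.subset_trans sub sYX.
exists [set x in s]; split=> //.
  rewrite cs /minn; case: ifP => _.
    apply: leq_trans (_ : 3 * uphalf #|X| <= _)%N; first by rewrite uphalf_half; lia.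
    by rewrite leq_mul2r leq_maxr orbT.
  by apply: leq_trans cY _; rewrite leq_mul2r leq_maxl orbT.
rewrite -card_gt0 cD => H.
apply: leq_trans (_ : 3 * (#|X| - minn (uphalf #|X|) #|Y|) <= _)%N.
  by move: H; rewrite uphalf_half /minn; case: ifP => ?; lia.
by rewrite leq_mul2r leq_maxr orbT.
Qed.

Section Density.
Variables (I T : finType).
Implicit Types (X Y Z : I -> {set T}) (H A : {set {ffun I -> T}}).

Definition box X : {set {ffun I -> T}} := [set t in family (fun i => mem (X i))].

Lemma in_box X (t : {ffun I -> T}) : reflect (forall i, t i \in X i) (t \in box X).
Proof. by rewrite inE; apply: familyP. Qed.

Lemma card_box X : #|box X| = (\prod_i #|X i|)%N.
Proof.
by rewrite cardsE card_family foldrE big_map big_enum.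
Qed.

Definition side X Y (b : {ffun I -> bool}) i := if b i then Y i else X i :\: Y i.

Lemma card_box_sides X Y H : (forall i, Y i \subset X i) ->
  #|box X :&: H| = (\sum_b #|box (side X Y b) :&: H|)%N.
Proof.
move=> sub; pose p (t : {ffun I -> T}) := [ffun i => t i \in Y i].
rewrite -sum1_card (partition_big p predT) //=.
apply: eq_bigr => b _; rewrite -sum1_card; apply: eq_bigl => t.
rewrite !in_setI andbAC; congr (_ && _); apply/andP/in_box.
  case=> /in_box tX /eqP <- i; rewrite /side ffunE.
  by case: ifP => // /negbT tY; rewrite inE tX tY.
move=> Hb; split; last first.
  apply/eqP/ffunP => i; rewrite ffunE; have := Hb i; rewrite /side.
  by case: (b i) => //; rewrite inE => /andP[/negPf].
apply/in_box => i; have := Hb i; rewrite /side.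
by case: (b i) => [/(fintype.subsetP (sub i))|]; rewrite ?inE // => /andP[].
Qed.

(* Density increment: a homogeneous box disjoint from [H] can be discarded, and
   one of the remaining boxes then has density larger by a fixed factor. *)
Lemma density_increment H N :
  (forall X, (forall i, X i != set0) ->
    exists2 Y, subbox N X Y & box Y \subset H \/ box Y :&: H = set0) ->
  forall n X, (forall i, X i != set0) ->
  let p := (maxn N 3 ^ #|I|)%N in
  (#|box X| * p ^ n <= p.+1 ^ n * #|box X :&: H|)%N ->
  exists2 Z, subbox (maxn N 3 ^ n) X Z & box Z \subset H.
Proof.
(* The remaining hypothesis says that [H] has density at least [(p / p.+1) ^ n] in [box X]; for
   [n = 0] the box lies inside [H]. *)
move=> Hom n X X0 p; set M := maxn N 3 in p *.
elim: n X X0 => [|n IH] X X0.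
  rewrite !expn0 muln1 mul1n => le; exists X; first by move=> i; rewrite mul1n.
  apply/setIidPl/eqP; rewrite eqEcard le andbT; exact: subsetIl.
move=> Hd; have [Y' XY' homY'] := Hom X X0.
have [Y HY] : exists Y : I -> {set T}, forall i, [/\ Y i \subset Y' i,
    (#|X i| <= M * #|Y i|)%N & X i :\: Y i != set0 -> (#|X i| <= M * #|X i :\: Y i|)%N].
  have Hex i : exists Yi : {set T}, [/\ Yi \subset Y' i, (#|X i| <= M * #|Yi|)%N &
      X i :\: Yi != set0 -> (#|X i| <= M * #|X i :\: Yi|)%N].
    by case: (XY' i) => s c; exact: halving_subset.
  by have [Y HY] := boolp.choice Hex; exists Y.
have sYX i : Y i \subset X i.
  by case: (HY i) (XY' i) => s _ _ [s' _]; exact: fintype.subset_trans s s'.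
have sbox : box Y \subset box Y'.
  apply/fintype.subsetP => t /in_box Ht; apply/in_box => i.
  by case: (HY i) => s _ _; apply: (fintype.subsetP s).
have sub : subbox M X Y by move=> i; split=> //; case: (HY i).
have M1 : (1 < M)%N by rewrite /M; lia.
case: homY' => [HY'|HY'].
  exists Y; last exact: fintype.subset_trans sbox HY'.
  by apply: subbox_le sub; rewrite expnS leq_pmulr // expn_gt0 ltnW.
have HY0 : box Y :&: H = set0.
  by apply/eqP; rewrite -subset0 -HY'; exact: setSI.
pose b1 : {ffun I -> bool} := [ffun=> true].
have Eb1 : box (side X Y b1) = box Y.
  by apply/setP => t; apply/in_box/in_box => Ht i; have := Ht i; rewrite /side ffunE.
have [/existsP[b /and3P[_ b0 db]]|] := boolP [exists b, [&& b != b1,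
   0 < #|box (side X Y b)| & #|box (side X Y b)| * p ^ n <=
   p.+1 ^ n * #|box (side X Y b) :&: H|]]%N.
  have side0 i : side X Y b i != set0.
    move: b0; rewrite card_gt0 => /set0Pn[t /in_box Ht].
    by apply/set0Pn; exists (t i).
  have [Z sZ HZ] := IH _ side0 db.
  exists Z => //; rewrite expnS; apply: subbox_trans sZ => i; split.
    by rewrite /side; case: ifP => // _; exact: subsetDl.
  have := side0 i; rewrite /side; case: ifP => _ H0; first by case: (HY i).
  by case: (HY i) => _ _; apply.
rewrite negb_exists => /forallP Hb; exfalso.
have volY : (#|box X| <= p * #|box Y|)%N.
  rewrite !card_box /p -[X in (M ^ X)%N]/#|I| -prod_nat_const -big_split /=.
  by apply: leq_prod => i _; case: (HY i).
have X_gt0 : (0 < #|box X|)%N by rewrite card_box prodn_gt0 // => i; rewrite card_gt0.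
(* If every other box stayed below density [(p / p.+1) ^ n], summing over them would bound the part
   of [H] outside [box Y], which is all of it. *)
have Hsum : (p.+1 ^ n * #|box X :&: H| + p ^ n * #|box Y| <= p ^ n * #|box X|)%N.
  rewrite (card_box_sides H sYX) -(setIT (box X)) (card_box_sides setT sYX).
  rewrite (bigD1 b1) //= [X in (_ <= _ * X)%N](bigD1 b1) //= Eb1 HY0 cards0 add0n setIT.
  rewrite mulnDr addnC leq_add2l !big_distrr /=; apply: leq_sum => b nb.
  move: (Hb b); rewrite nb setIT /= negb_and -leqNgt leqn0 -ltnNge.
  case/orP => [/eqP b0|/ltnW]; last by rewrite mulnC [X in (_ <= X)%N]mulnC mulnC.
  suff /eqP -> : #|box (side X Y b) :&: H| == 0%N by rewrite muln0.
  by rewrite -leqn0 -b0 subset_leq_card // subsetIl.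
have pn : (0 < p ^ n)%N by rewrite !expn_gt0 ltnW.
move: Hd Hsum volY X_gt0 pn; rewrite !expnS.
move: (p ^ n)%N (p.+1 ^ n)%N #|box X| #|box Y| #|box X :&: H| => a c x y h.
move=> H1 H2 H3 x0 a0.
(* This yields [p.+1 * y <= x], against [x <= p * y] and [0 < x]. *)
have : (p * (a * x) + p.+1 * (a * y) <= p.+1 * (a * x))%N.
  apply: leq_trans (_ : p.+1 * (c * h + a * y) <= _)%N; last by rewrite leq_mul2l H2 orbT.
  by rewrite mulnDr leq_add2r; move: H1; rewrite [(x * _)%N]mulnC -!mulnA.
rewrite [(p.+1 * (a * x))%N]mulSn addnC leq_add2r mulnCA leq_mul2l.
rewrite gtn_eqF //= mulSn => H4.
have y0 : y = 0%N by apply/eqP; lia.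
by move: H3 x0; rewrite y0 muln0; lia.
Qed.

(** Double counting: an injective tuple is properly coloured by [#|I| ^ (#|T| - #|I|)] of the
    [#|I| ^ #|T|] colourings, and some colouring attains the average. *)
Lemma partition_average A : (0 < #|I|)%N ->
  {in A, forall t : {ffun I -> T}, injective t} ->
  exists f : {ffun T -> I},
    (#|A| <= #|I| ^ #|I| * #|box (fun i => [set x | f x == i]) :&: A|)%N.
Proof.
move=> I0 inj; pose cls (f : {ffun T -> I}) i := [set x | f x == i].
have [->|/set0Pn[t0 At0]] := eqVneq A set0.
  by have /card_gt0P[i _] := I0; exists [ffun=> i]; rewrite cards0.
(* Keeps the truncated subtraction in the exponent exact. *)
have leIT : (#|I| <= #|T|)%N by apply: leq_card (inj _ At0).
have Hfib t : t \in A ->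
    #|[set f : {ffun T -> I} | t \in box (cls f)]| = (#|I| ^ (#|T| - #|I|))%N.
  move=> At; pose Q x := [pred j | [forall i, (t i == x) ==> (j == i)]].
  have -> : #|[set f : {ffun T -> I} | t \in box (cls f)]| = #|family Q|.
    apply: eq_card => f; rewrite inE; apply/in_box/familyP => Hf.
      move=> x; rewrite inE; apply/forallP => i; apply/implyP => /eqP <-.
      by have := Hf i; rewrite inE.
    by move=> i; have := Hf (t i); rewrite !inE => /forallP/(_ i); rewrite eqxx.
  rewrite card_family foldrE big_map big_enum /=.
  rewrite (bigID (fun x => x \in codom t)) /= big1 ?mul1n; last first.
    move=> x /codomP[i ->]; rewrite -(card1 i); apply: eq_card => j.
    rewrite !inE; apply/forallP/eqP => [/(_ i)|-> i']; first by rewrite eqxx => /eqP.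
    by apply/implyP => /eqP/(inj _ At) ->.
  rewrite (eq_bigr (fun=> #|I|)); last first.
    move=> x Hx; apply: eq_card => j; rewrite !inE; apply/forallP => i.
    by apply/implyP => /eqP e; move: Hx; rewrite -e codom_f.
  rewrite prod_nat_const; congr (_ ^ _)%N.
  have := cardC (mem (codom t)); rewrite (card_codom (inj _ At)) => <-.
  by rewrite addKn; apply: eq_card => x; rewrite !inE.
have Hsum : (\sum_f #|box (cls f) :&: A| = #|A| * #|I| ^ (#|T| - #|I|))%N.
  rewrite -sum_nat_const (eq_bigr (fun f => \sum_(t in A) (t \in box (cls f)))%N); last first.
    move=> f _; rewrite -sum1_card big_mkcond [RHS]big_mkcond; apply: eq_bigr => t _.
    by rewrite in_setI andbC; case: (t \in A); case: (t \in box _).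
  rewrite exchange_big /=; apply: eq_bigr => t At; rewrite -(Hfib t At) -sum1_card.
  by rewrite [RHS]big_mkcond; apply: eq_bigr => f _; rewrite inE; case: (t \in _).
have [/existsP[f Hf]|] := boolP [exists f : {ffun T -> I},
  #|A| <= #|I| ^ #|I| * #|box (cls f) :&: A|]%N; first by exists f.
rewrite negb_exists => /forallP Hall; exfalso.
have A0 : (0 < #|A|)%N by apply/card_gt0P; exists t0.
have : (\sum_(f : {ffun T -> I}) #|I| ^ #|I| * #|box (cls f) :&: A| <=
    \sum_(f : {ffun T -> I}) #|A|.-1)%N.
  by apply: leq_sum => f _; rewrite -ltnS prednK // ltnNge Hall.
rewrite -big_distrr /= Hsum mulnCA -expnD subnKC // sum_nat_const card_ffun mulnC.
by rewrite leq_mul2l expn_eq0 -(prednK A0) ltnn orbF; case: #|I| I0.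
Qed.

End Density.

(** * Order types *)

(** Induction through the absorption identity for binomials, with [k * n.+1 <= k.+1 * n] for
    [k <= n]. *)
Lemma expn_le_bin n k : (k <= n -> n ^ k <= k ^ k * 'C(n, k))%N.
Proof.
elim: k n => [|k IH] [|n]; rewrite ?bin0 //.
rewrite ltnS => le.
have [k0|k_gt0] := posnP k; first by rewrite k0 bin1 expn1 mul1n.
have H : (n.+1 ^ k <= k.+1 ^ k * 'C(n, k))%N.
  rewrite -(@leq_pmul2l (k ^ k)) ?expn_gt0 ?k_gt0 //.
  apply: leq_trans (_ : k.+1 ^ k * n ^ k <= _)%N.
    by rewrite -!expnMn leq_exp2r // mulnS mulSn; lia.
  by rewrite mulnCA leq_mul2l IH ?orbT.
by rewrite !expnS -mulnA mulnCA -mul_bin_diag mulnCA leq_mul2l H orbT.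
Qed.

(** Bernoulli's inequality [1 + s/p <= (1 + 1/p)^s] with denominators cleared. *)
Lemma bernoulli_nat p s : (p ^ s * (p + s) <= p.+1 ^ s * p)%N.
Proof.
elim: s => [|s IH]; first by rewrite addn0.
rewrite !expnS; apply: leq_trans (_ : p.+1 * (p ^ s * (p + s)) <= _)%N.
  by rewrite -mulnA mulnCA [(p.+1 * _)%N]mulnCA leq_mul2l; apply/orP; right; lia.
by rewrite -mulnA leq_mul2l IH orbT.
Qed.

Section OrderType.
Variables (R : realType) (d k : nat) (P rho : {fset 'rV[R]_d}).

(** Tuples may repeat points, so membership depends on orientations alone and is constant on
    same-type boxes; injectivity is restored later by disjointness of the factors. *)
Definition has_type : {set {ffun 'I_k -> P}} :=
  [set t : {ffun 'I_k -> P} | `[< exists2 l : 'I_k -> rho, bijective l &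
     forall e : 'I_d.+1 -> 'I_k, (forall a b : 'I_d.+1, (a < b)%N -> (e a < e b)%N) ->
       chi (fun a => val (t (e a))) = chi (fun a => val (l (e a))) >]].

Lemma increasing_inj (e : 'I_d.+1 -> 'I_k) :
  (forall a b : 'I_d.+1, (a < b)%N -> (e a < e b)%N) -> injective e.
Proof.
move=> H a b eab; apply/val_inj; case: (ltngtP a b) => // /H;
by rewrite eab ltnn.
Qed.

(** Each copy of [rho] is the image of the tuple given by its labelling, so distinct copies come
    from distinct tuples. *)
Lemma order_types_le_tuples :
  (#|` [fset S in fpowerset P | (#|` S| == k) && `[< same_order_type k S rho >]]%fset|
   <= #|[set t in has_type | injectiveb t]|)%N.
Proof.
pose A := [set t in has_type | injectiveb t].
pose img (t : {ffun 'I_k -> P}) := [fset val (t i) | i : 'I_k]%fset.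
apply: leq_trans (_ : #|` [fset img t | t in A]%fset| <= _)%N; last first.
  by apply: leq_trans (leq_imfset_card _ _ _) _; rewrite -cardE.
apply: fsubset_leq_card; apply/fsubsetP => S.
rewrite in_fsetE !inE => /andP[]; rewrite fpowersetE => SP.
move=> /andP[_ /asboolP[lA [lB [bA bB H]]]].
have inP i : val (lA i) \in P by apply: (fsubsetP SP); exact: valP.
pose t := [ffun i => FSetSub (inP i)].
apply/imfsetP; exists t => /=.
  rewrite !inE; apply/andP; split.
    apply/asboolP; exists lB => // e He; rewrite -H //; congr chi.
    by apply/funext => a; rewrite ffunE.
  apply/injectiveP => i j; rewrite !ffunE => /(congr1 val) /= /val_inj.
  exact: (bij_inj bA).
apply/fsetP => x; apply/idP/imfsetP => [xS|[i _ ->]]; last by rewrite ffunE /=; exact: valP.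
case: bA => g _ gK; exists (g [` xS]%fset) => //.
by rewrite ffunE /= gK.
Qed.

Lemma has_type_homogeneous (Y : 'I_k -> {set P}) :
  (forall e : 'I_d.+1 -> 'I_k, injective e -> exists s, forall t : 'I_k -> P,
     (forall i, t i \in Y i) -> chi (fun a => val (t (e a))) = s) ->
  box Y \subset has_type \/ box Y :&: has_type = set0.
Proof.
move=> H; have [|/set0Pn[t0]] := eqVneq (box Y :&: has_type) set0; first by right.
rewrite in_setI => /andP[/in_box Y0]; rewrite inE => /asboolP[l bl Hl]; left.
apply/fintype.subsetP => t /in_box Yt; rewrite inE; apply/asboolP; exists l => // e He.
have [s Hs] := H e (increasing_inj He).
by rewrite -Hl // !Hs.
Qed.

Lemma has_type_same (t : {ffun 'I_k -> P}) (x : 'I_k -> 'rV[R]_d) :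
  t \in has_type -> injective t -> (forall i, x i = val (t i)) ->
  same_order_type k [fset x i | i : 'I_k]%fset rho.
Proof.
rewrite inE => /asboolP[l bl Hl] injt Ex.
have xin i : x i \in [fset x i | i : 'I_k]%fset by apply/imfsetP; exists i.
exists (fun i => FSetSub (xin i)), l; split=> //.
  apply: inj_card_bij.
    by move=> i j /(congr1 val) /=; rewrite !Ex => /val_inj/injt.
  rewrite -cardfE; apply: leq_trans (leq_imfset_card _ _ _) _.
  by rewrite size_enum_ord card_ord.
by move=> e He; rewrite -Hl //; congr chi; apply/funext => a /=; rewrite Ex.
Qed.

End OrderType.

(** * From many copies of an order type to disjoint homogeneous sets *)

Local Open Scope fset_scope.

Theorem proposition1 (R : realType) (d k : nat) (delta : R)
    (hd : (1 <= d)%N) (hk : (1 <= k)%N) (hdelta : 0 < delta) :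
  exists c : R, 0 < c /\
    forall (n : nat) (P rho : {fset 'rV[R]_d}),
      (k <= n)%N -> #|` P| = n -> #|` rho| = k ->
      general_position P -> general_position rho ->
      delta * 'C(n, k)%:R <=
        #|` [fset S in fpowerset P
              | (#|` S| == k) && `[< same_order_type k S rho >]]|%:R ->
      exists X : 'I_k -> {fset 'rV[R]_d},
        [/\ forall i, X i `<=` P,
            forall i j, i != j -> [disjoint X i & X j],
            forall i, c * n%:R <= #|` X i|%:R &
            forall x : 'I_k -> 'rV[R]_d, (forall i, x i \in X i) ->
              same_order_type k [fset x i | i : 'I_k] rho].
Proof.
have [N HN] := same_type R 'I_k d.
pose M := maxn N 3; pose p := (M ^ k)%N.
have M0 : (0 < M)%N by rewrite /M leq_max orbT.
(* An integer above [delta^-1], so that the counting can be done in natural numbers. *)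
pose Q := (Num.truncn delta^-1).+1.
have HQ : delta^-1 <= Q%:R by apply/ltW; exact: truncnS_gt.
(* One [k ^ k] compares [n ^ k] with the binomial, [Q] is the density of copies, and the other
   [k ^ k] is lost in the colouring. *)
pose q := (k ^ k * Q * k ^ k)%N.
have q0 : (0 < q)%N by rewrite !muln_gt0 !expn_gt0 hk.
(* Number of density increments: by Bernoulli, [(p.+1 / p) ^ s] exceeds [q], so the initial density
   [1 / q] suffices. *)
pose s := (p * q)%N.
have Hs : (q * p ^ s <= p.+1 ^ s)%N.
  have p0 : (0 < p)%N by rewrite expn_gt0 M0.
  rewrite -(leq_pmul2r p0); apply: leq_trans (bernoulli_nat p s).
  by rewrite mulnAC mulnC leq_mul2l /s mulnC leq_addl orbT.
have qM0 : (0 < q * M ^ s)%N by rewrite muln_gt0 q0 expn_gt0 M0.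
(* A colour class has at least [n / q] points, and the density increments keep a fraction
   [1 / M ^ s] of it. *)
exists ((q * M ^ s)%N%:R^-1); split; first by rewrite invr_gt0 ltr0n.
move=> n P rho kn cP crho _ _ Hdelta.
pose H := has_type k P rho; pose A := [set t in H | injectiveb t].
have HA : ('C(n, k) <= Q * #|A|)%N.
  rewrite -(ler_nat R) natrM -(ler_pM2l hdelta) mulrA.
  apply: le_trans Hdelta _; apply: le_trans (_ : #|A|%:R <= _).
    by rewrite ler_nat; exact: order_types_le_tuples.
  apply: ler_peMl; first exact: ler0n.
  by rewrite mulrC -ler_pdivrMr // mul1r.
have [|t|f Hf] := @partition_average 'I_k P A; first by rewrite card_ord.
  by rewrite inE => /andP[_ /injectiveP].
pose X i := [set x | f x == i].
have n0 : (0 < n)%N by apply: leq_trans kn.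
have cardP : #|{: P}| = n by rewrite -cardfE.
have Hq : (n ^ k <= q * #|box X :&: H|)%N.
  apply: leq_trans (expn_le_bin kn) _; rewrite /q -!mulnA leq_mul2l; apply/orP; right.
  apply: leq_trans HA _; rewrite leq_mul2l; apply/orP; right.
  apply: leq_trans Hf _; rewrite card_ord leq_mul2l; apply/orP; right.
  by apply/subset_leq_card/setIS/fintype.subsetP => t; rewrite inE => /andP[].
have leX i : (#|X i| <= n)%N by rewrite -cardP max_card.
(* No factor can be small: the box has at least [n ^ k / q] tuples, but at most
   [#|X i| * n ^ k.-1]. *)
have nX i : (n <= q * #|X i|)%N.
  have E : (n ^ k = n * n ^ k.-1)%N by rewrite -expnS prednK.
  rewrite -(@leq_pmul2r (n ^ k.-1)) ?expn_gt0 ?n0 // -E.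
  apply: leq_trans Hq _; rewrite -mulnA leq_mul2l; apply/orP; right.
  apply: leq_trans (subset_leq_card (subsetIl _ _)) _.
  rewrite card_box (bigD1 i) //= leq_mul2l; apply/orP; right.
  apply: leq_trans (_ : \prod_(j < k | j != i) n <= _)%N; first exact: leq_prod.
  by rewrite prod_nat_const cardC1 card_ord.
have X0 i : X i != set0.
  by rewrite -card_gt0; have := leq_trans n0 (nX i); rewrite muln_gt0 => /andP[].
pose v (x : P) : 'rV[R]_d.+1 := row_mx (1%:M : 'M[R]_1) (val x) : 'rV[R]_(1 + d).
have [||Z XZ ZH] := @density_increment 'I_k P H N _ s X X0.
- move=> X' X'0; have [Y XY HY] := HN P v X' X'0; exists Y => //.
  by apply: has_type_homogeneous.
- rewrite card_ord -/M -/p.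
  apply: leq_trans (_ : q * #|box X :&: H| * p ^ s <= _)%N.
    rewrite leq_mul2r; apply/orP; right; apply: leq_trans Hq.
    rewrite card_box -[X in (n ^ X)%N](card_ord k) -prod_nat_const.
    exact: leq_prod.
  by rewrite mulnAC leq_mul2r Hs orbT.
(* The factors lie in distinct colour classes; this gives both disjointness and injectivity of
   transversals. *)
have disjZ i j x : x \in Z i -> x \in Z j -> i = j.
  case: (XZ i) => /fintype.subsetP si _; case: (XZ j) => /fintype.subsetP sj _.
  by move=> /si + /sj; rewrite !inE => /eqP <- /eqP.
exists (fun i => [fset val x | x in Z i]); split.
- by move=> i; apply/fsubsetP => x /imfsetP[y _ ->]; exact: valP.
- move=> i j ij; apply/fdisjointP => x /imfsetP[y /= Zy ->]; apply/negP.
  move=> /imfsetP[z /= Zz /val_inj yz]; move: ij; rewrite -{}yz in Zz.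
  by rewrite (disjZ _ _ _ Zy Zz) eqxx.
- move=> i; rewrite card_imfset /=; last exact: val_inj.
  rewrite -cardE ler_pdivrMl ?ltr0n // -natrM ler_nat.
  apply: leq_trans (nX i) _; rewrite -mulnA leq_mul2l; apply/orP; right.
  by case: (XZ i).
move=> x Hx.
have /boolp.choice[t Ht] : forall i, exists y, y \in Z i /\ x i = val y.
  by move=> i; have /imfsetP[y /= Zy ->] := Hx i; exists y.
apply: (@has_type_same R d k P rho (finfun t)).
- apply: (fintype.subsetP ZH); apply/in_box => i; rewrite ffunE; exact: (Ht i).1.
- move=> i j; rewrite !ffunE => e; apply: (disjZ i j (t i)); first exact: (Ht i).1.
  by rewrite e; exact: (Ht j).1.
- by move=> i; rewrite ffunE; exact: (Ht i).2.
Qed.
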